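(* Let $P, C \in \mathbb{R}_{\geq 0}^{n\times d}$ and $\epsilon \in [(nd)^{-3}, 1/20]$, and run the diagonal (linear programming) specialization of Algorithm 1 described in the context on $(P, C, \epsilon)$. Assume that in the iteration under consideration every entry of $b = C(\alpha\delta^{(t)}\circ x^{(t)})$ lies in $[(nd\rho)^{-5}, (nd\rho)^{5}]$. Then for any iteration $t$ of the algorithm in which the update $x^{(t+1)}_i = x^{(t)}_i(1+\alpha\delta^{(t)}_i)$ is performed, \[ f(x^{(t+1)}) \le f(x^{(t)}) + (nd\rho)^{-15}, \] where $f(x) := \log \sum_{j\in[n]} \exp([Px]_j) + \log\sum_{j\in[n]}\exp(-[Cx]_j)$.
   Context: Notation: $P_{:i}, C_{:i}$ denote the $i$-th columns; $\mathbf{1}_n$ is the all-ones vector; $x\circ y$ is the entrywise product and $\delta^2 = \delta\circ\delta$; $\exp$ of a vector is entrywise. The width is $\rho := \max_{i\in[d]} \frac{\max_j C_{ji}}{\max_j P_{ji}}$ (assume every column of $P$ is nonzero). Algorithm (LP specialization of Algorithm 1): set $K = 4\log(nd\rho)/\epsilon$, $\alpha = 1/(8K)$, $x^{(0)}_i = 1/(d\max_j P_{ji})$, $t=0$. While $\max_j [Px^{(t)}]_j \le K$ and $\min_j [Cx^{(t)}]_j \le K$: compute $\nabla_{P_i}^{(t)} = \langle P_{:i}, \exp(Px^{(t)})/\mathbf{1}_n^\top\exp(Px^{(t)})\rangle$ and $\nabla_{C_i}^{(t)} = \langle C_{:i}, \exp(-Cx^{(t)})/\mathbf{1}_n^\top\exp(-Cx^{(t)})\rangle$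 for all $i$; let $W^{(t)} = \{i : \nabla_{P_i}^{(t)} \le (1-\epsilon/2)\nabla_{C_i}^{(t)}\}$; if $W^{(t)}=\emptyset$ return ''Infeasible''; set $\delta^{(t)}_i = \frac12(1 - \nabla_{P_i}^{(t)}/\nabla_{C_i}^{(t)})$ for $i\in W^{(t)}$ and $\delta^{(t)}_i = 0$ otherwise; set $x^{(t+1)}_i = x^{(t)}_i(1+\alpha\delta^{(t)}_i)$ and $t\gets t+1$. After the loop, return ''Feasible'' and $x^{(t)}$. *)

(* Defs.v *)
From HB Require Import structures.
From mathcomp Require Import all_boot all_order all_algebra.
From mathcomp Require Import all_classical all_reals all_analysis.
Set Implicit Arguments.
Unset Strict Implicit.
Unset Printing Implicit Defensive.
Import Order.TTheory GRing.Theory Num.Theory.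
Local Open Scope ring_scope.
Local Open Scope classical_set_scope.

(* Maximum and minimum of a nonempty finite family. As suprema and infima in R
   they are 0 when n = 0. *)
Definition vmax (R : realType) n (v : 'I_n -> R) : R := sup (range v).
Definition vmin (R : realType) n (v : 'I_n -> R) : R := inf (range v).

Lemma vmax_attained (R : realType) n (v : 'I_n -> R) : (0 < n)%N ->
  exists2 j, v j = vmax v & forall k, v k <= vmax v.
Proof.
case: n v => // n v _.
pose j := [arg max_(j > ord0) v j]%O.
have jmax k : v k <= v j by rewrite /j; case: arg_maxP => // i _ /(_ k); exact.
have vE : vmax v = v j.
  apply/eqP; rewrite eq_le; apply/andP; split.
    by apply: ge_sup; [exists (v j), j | move=> _ [k _ <-]].
  by apply: ub_le_sup; [exists (v j) => _ [k _ <-] | exists j].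
by exists j => [|k]; rewrite vE.
Qed.

Lemma vmin_attained (R : realType) n (v : 'I_n -> R) : (0 < n)%N ->
  exists2 j, v j = vmin v & forall k, vmin v <= v k.
Proof.
case: n v => // n v _.
pose j := [arg min_(j < ord0) v j]%O.
have jmin k : v j <= v k by rewrite /j; case: arg_minP => // i _ /(_ k); exact.
have vE : vmin v = v j.
  apply/eqP; rewrite eq_le; apply/andP; split.
    by apply: ge_inf; [exists (v j) => _ [k _ <-] | exists j].
  by apply: lb_le_inf; [exists (v j), j | move=> _ [k _ <-]].
by exists j => [|k]; rewrite vE.
Qed.

Definition softmax (R : realType) n (v : 'cV[R]_n) : 'cV[R]_n :=
  \col_j (expR (v j 0) / \sum_k expR (v k 0)).

Inductive status (R : realType) (d : nat) :=
  | Running of 'cV[R]_d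
  | Feasible of 'cV[R]_d
  | Infeasible.
Arguments Infeasible {R d}.

Section Algorithm.
Variables (R : realType) (n d : nat) (P C : 'M[R]_(n, d)) (eps : R).

Definition width : R :=
  vmax (fun i : 'I_d => vmax (fun j => C j i) / vmax (fun j => P j i)).

Definition ndrho : R := n%:R * d%:R * width.

Definition threshold : R := 4 * ln ndrho / eps.

Definition alpha : R := 1 / (8 * threshold).

Definition x_init : 'cV[R]_d := \col_i (1 / (d%:R * vmax (fun j => P j i))).

(* Entry i is the inner product of the i-th column of P (resp. C) with the
   normalized exponential of P x (resp. - C x). *)
Definition gradP (x : 'cV[R]_d) : 'cV[R]_d := P^T *m softmax (P *m x).
Definition gradC (x : 'cV[R]_d) : 'cV[R]_d := C^T *m softmax (- (C *m x)).

Definition wset (x : 'cV[R]_d) : {set 'I_d} :=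
  [set i | gradP x i 0 <= (1 - eps / 2) * gradC x i 0]%SET.

Definition delta (x : 'cV[R]_d) : 'cV[R]_d :=
  \col_i (if i \in wset x then 1 / 2 * (1 - gradP x i 0 / gradC x i 0) else 0).

Definition update (x : 'cV[R]_d) : 'cV[R]_d :=
  \col_i (x i 0 * (1 + alpha * delta x i 0)).

Definition continue_loop (x : 'cV[R]_d) : bool :=
  (vmax (fun j => (P *m x) j 0) <= threshold) &&
  (vmin (fun j => (C *m x) j 0) <= threshold).

Definition step (s : status R d) : status R d :=
  match s with
  | Running x =>
      if continue_loop x then
        if wset x == finset.set0 then Infeasible else Running (update x)
      else Feasible x
  | _ => s
  end.

(* [run t = Running x] means that the algorithm has not returned before testing
   the loop condition for the t-th time (from 0), and that x is then x^(t); the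
   update is performed in iteration t iff moreover [run t.+1] is [Running]. *)
Definition run (t : nat) : status R d := iter t step (Running x_init).

Definition bvec (x : 'cV[R]_d) : 'cV[R]_n :=
  C *m (alpha *: map2_mx *%R (delta x) x).

Definition potential (x : 'cV[R]_d) : R :=
  ln (\sum_j expR ((P *m x) j 0)) + ln (\sum_j expR (- (C *m x) j 0)).

End Algorithm.

(* Main.v *)
(* Let N = ndrho and K = threshold. One update adds a = sum_i w_i alpha delta_i
   to each row of P x (with w_i = P_ji x_i) and of C x (with w_i = C_ji x_i).
   By Cauchy-Schwarz, on a row whose weights sum to O(K) the square a^2 is
   O(1) times sum_i w_i alpha delta_i^2, so the second-order terms
   of exp(a) and exp(-a) only perturb the coefficients delta_i by a factor
   1 +- delta_i / 4; since gradP_i <= (1 - 2 delta_i) gradC_i, the first-order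
   decrease wins. The rows with (C x)_j > 2K have softmax weight at most
   exp(-K) <= N^-16, because min (C x) <= K, and their first-order term is at most
   (C x)_j / (16 K) <= N / n: indeed C_ji <= width * max_j P_ji, and
   x_i * max_j P_ji <= max (P x) <= K. *)
Require Import Defs.
From mathcomp Require Import all_boot all_order all_algebra.
From mathcomp Require Import all_classical all_reals all_analysis.
From mathcomp Require Import ring lra.
Import Order.TTheory GRing.Theory Num.Theory.
Local Open Scope ring_scope.

(** * Scalar inequalities: weighted Cauchy-Schwarz and quadratic bounds on exp *)

(** Expand sum w_i (K y_i - U)^2 >= 0, where U = sum w_i y_i, bound the total weight by [K] in the
    U^2 term, and cancel one factor [K]. *)
Lemma weighted_cauchy_schwarz (R : realFieldType) (I : finType) (w y : I -> R)
    (K : R) : 0 < K -> (forall i, 0 <= w i) -> \sum_i w i <= K ->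
  (\sum_i w i * y i) ^+ 2 <= K * \sum_i w i * y i ^+ 2.
Proof.
move=> K0 w0 wK; set U := \sum_i w i * y i; set T := \sum_i w i * y i ^+ 2.
have : 0 <= \sum_i w i * (K * y i - U) ^+ 2.
  by apply: sumr_ge0 => i _; rewrite mulr_ge0 // sqr_ge0.
have -> : \sum_i w i * (K * y i - U) ^+ 2 =
    K ^+ 2 * T - 2 * K * U * U + U ^+ 2 * \sum_i w i.
  transitivity (\sum_i (K ^+ 2 * (w i * y i ^+ 2) - 2 * K * U * (w i * y i)
                         + U ^+ 2 * w i)).
    by apply: eq_bigr => i _; ring.
  by rewrite big_split sumrB -!mulr_sumr.
have : U ^+ 2 * \sum_i w i <= U ^+ 2 * K by rewrite ler_wpM2l // sqr_ge0.
move=> h1 h2; rewrite -(ler_pM2l K0); nra.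
Qed.

(** Since exp(-a) >= 1 - a, we have (1 - a) exp(a) <= 1, while (1 - a)(1 + a + 2a^2) = 1 + a^2 (1 -
    2a) >= 1. *)
Lemma expR_le_quad (R : realType) (a : R) : 0 <= a <= 1 / 2 ->
  expR a <= 1 + a + 2 * a ^+ 2.
Proof.
move=> /andP[a0 a1]; have := expR_ge1Dx (- a); rewrite expRN => h.
have e0 : 0 < expR a := expR_gt0 a.
have : (1 - a) * expR a <= 1 by rewrite -ler_pdivlMr // div1r.
nra.
Qed.

Lemma expRN_le_quad (R : realType) (b : R) : 0 <= b ->
  expR (- b) <= 1 - b + b ^+ 2.
Proof.
move=> b0; rewrite expRN -div1r ler_pdivrMr ?expR_gt0 //.
have q0 : 0 <= 1 - b + b ^+ 2 by nra.
apply: le_trans (ler_wpM2l q0 (expR_ge1Dx b)).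
have -> : (1 - b + b ^+ 2) * (1 + b) = 1 + b ^+ 3 by ring.
by rewrite lerDl exprn_ge0.
Qed.

(** * Effect of one multiplicative step on a single row *)

Section MultiplicativeStep.
Variables (R : realType) (I : finType) (w dl : I -> R) (K : R).
Hypotheses (K0 : 0 < K) (w0 : forall i, 0 <= w i).
Hypothesis dlP : forall i, 0 <= dl i <= 1 / 2.
Let al : R := 1 / (8 * K).

Let al0 : 0 < al. Proof. by rewrite /al divr_gt0 // mulr_gt0. Qed.
Let alK : al * K = 1 / 8. Proof. by rewrite /al; field; rewrite gt_eqF. Qed.

Lemma step_ge0 : 0 <= \sum_i w i * (al * dl i).
Proof.
apply: sumr_ge0 => i _; have /andP[d0 _] := dlP i.
by rewrite mulr_ge0 // (mulr_ge0 (ltW al0)).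
Qed.

Lemma step_le : \sum_i w i * (al * dl i) <= (\sum_i w i) / (16 * K).
Proof.
rewrite mulr_suml; apply: ler_sum => i _; rewrite ler_wpM2l //.
have -> : (16 * K)^-1 = al * (1 / 2) by rewrite /al; field; rewrite gt_eqF.
by rewrite ler_wpM2l ?(ltW al0) //; have /andP[] := dlP i.
Qed.

(** Cauchy-Schwarz leaves L K al^2 dl_i^2, and one factor al absorbs K through al K = 1/8. Rows of P
    use L = 1, rows of C use L = 2. *)
Lemma sqr_step_le (L : R) : 0 < L -> \sum_i w i <= L * K ->
  (\sum_i w i * (al * dl i)) ^+ 2
    <= L / 8 * \sum_i w i * (al * dl i * dl i).
Proof.
move=> L0 wK.
apply: le_trans (weighted_cauchy_schwarz _ _ w (fun i => al * dl i) _
  (mulr_gt0 L0 K0) w0 wK) _.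
rewrite !mulr_sumr le_eqVlt; apply/orP; left; apply/eqP.
apply: eq_bigr => i _.
have -> : L / 8 = L * (al * K) by rewrite alK; field.
ring.
Qed.

(** Here a <= 1/16, so the quadratic bound applies; its term 2 a^2 costs 2/8 = 1/4 of the
    second-order sum, hence the factor 1 + dl_i / 4. *)
Lemma expR_step_le : \sum_i w i <= K ->
  expR (\sum_i w i * (al * dl i))
    <= 1 + \sum_i w i * (al * dl i * (1 + dl i / 4)).
Proof.
move=> wK; set a := \sum_i w i * (al * dl i).
have a0 : 0 <= a by exact: step_ge0.
have a1 : a <= 1 / 2.
  apply: le_trans step_le _.
  by rewrite ler_pdivrMr ?mulr_gt0 //; have := K0; lra.
apply: le_trans (expR_le_quad _ _ _) _; first by rewrite a0.
have := sqr_step_le 1 ltr01; rewrite mul1r => /(_ wK); rewrite -/a => sq.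
have -> : \sum_i w i * (al * dl i * (1 + dl i / 4)) =
    a + 1 / 4 * \sum_i w i * (al * dl i * dl i).
  by rewrite /a mulr_sumr -big_split /=; apply: eq_bigr => i _; field.
lra.
Qed.

Let sumE : \sum_i w i * (al * dl i * (1 - dl i / 4)) =
  \sum_i w i * (al * dl i) - 1 / 4 * \sum_i w i * (al * dl i * dl i).
Proof. by rewrite mulr_sumr -sumrB; apply: eq_bigr => i _; field. Qed.

Lemma expRN_step_le : \sum_i w i <= 2 * K ->
  expR (- \sum_i w i * (al * dl i))
    <= 1 - \sum_i w i * (al * dl i * (1 - dl i / 4)).
Proof.
move=> wK; apply: le_trans (expRN_le_quad _ _ step_ge0) _.
by have := sqr_step_le 2 (ltr0Sn _ _) wK; rewrite sumE; lra.
Qed.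

(** With no bound on the total weight, exp(-a) <= 1 suffices: the subtracted sum is at most a, which
    the last term dominates. *)
Lemma expRN_step_le_large :
  expR (- \sum_i w i * (al * dl i))
    <= 1 - \sum_i w i * (al * dl i * (1 - dl i / 4))
         + (\sum_i w i) / (16 * K).
Proof.
have e1 : expR (- \sum_i w i * (al * dl i)) <= 1.
  by rewrite -expR0 ler_expR oppr_le0 step_ge0.
have s0 : 0 <= \sum_i w i * (al * dl i * dl i).
  apply: sumr_ge0 => i _; have /andP[d0 _] := dlP i.
  by rewrite mulr_ge0 // mulr_ge0 // (mulr_ge0 (ltW al0)).
by have := step_le; rewrite sumE; lra.
Qed.

End MultiplicativeStep.

(** * Softmax weights and the increment of log-sum-exp *)

Lemma softmax_ge0 (R : realType) n (v : 'cV[R]_n) j : 0 <= softmax v j 0.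
Proof.
by rewrite mxE divr_ge0 ?expR_ge0 //; apply: sumr_ge0 => k _; exact: expR_ge0.
Qed.

Lemma sum_expR_gt0 (R : realType) n (v : 'cV[R]_n) : (0 < n)%N ->
  0 < \sum_j expR (v j 0).
Proof.
case: n v => // n v _; rewrite big_ord_recl ltr_pwDl ?expR_gt0 //.
by apply: sumr_ge0 => k _; exact: expR_ge0.
Qed.

(** Only the k-th term of the normalizing sum is kept. *)
Lemma softmax_le (R : realType) n (v : 'cV[R]_n) j k :
  softmax v j 0 <= expR (v j 0 - v k 0).
Proof.
rewrite mxE expRD expRN ler_wpM2l ?expR_ge0 // lef_pV2 ?posrE ?expR_gt0 //.
  rewrite (bigD1 k) //= lerDl; apply: sumr_ge0 => i _; exact: expR_ge0.
rewrite (bigD1 k) //= ltr_pwDl ?expR_gt0 //.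
by apply: sumr_ge0 => i _; exact: expR_ge0.
Qed.

(** The ratio of the two sums minus 1 is the softmax average of exp(a_j) - 1, and ln q <= q - 1. *)
Lemma log_sum_exp_increment (R : realType) n (v a : 'cV[R]_n) : (0 < n)%N ->
  ln (\sum_j expR ((v + a) j 0)) <=
    ln (\sum_j expR (v j 0)) + \sum_j softmax v j 0 * (expR (a j 0) - 1).
Proof.
move=> n0; set S := \sum_j expR (v j 0).
have S0 : 0 < S by exact: sum_expR_gt0.
have -> : \sum_j softmax v j 0 * (expR (a j 0) - 1) =
    (\sum_j expR ((v + a) j 0)) / S - 1.
  under eq_bigr => j _ do rewrite mxE -/S mulrBr mulr1 mulrAC -expRD.
  rewrite sumrB -!mulr_suml divff ?gt_eqF //.
  by under [in RHS]eq_bigr do rewrite mxE.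
have T0 : 0 < \sum_j expR ((v + a) j 0) by exact: sum_expR_gt0.
rewrite -lerBlDl -ln_div ?posrE //.
have Q0 : 0 < (\sum_j expR ((v + a) j 0)) / S by rewrite divr_gt0.
have := expR_ge1Dx (ln ((\sum_j expR ((v + a) j 0)) / S)).
by rewrite lnK ?posrE // => h; lra.
Qed.

(** Turns softmax averages of row bounds into sums over coordinates with gradient coefficients. *)
Lemma trmx_mul_softmax_sum (R : realType) n d (A : 'M[R]_(n, d)) v
    (z : 'I_d -> R) :
  \sum_j softmax v j 0 * \sum_i A j i * z i =
  \sum_i (A^T *m softmax v) i 0 * z i.
Proof.
under eq_bigr do rewrite mulr_sumr.
rewrite exchange_big /=; apply: eq_bigr => i _.
rewrite [in RHS]mxE mulr_suml; apply: eq_bigr => j _.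
by rewrite [A^T i j]mxE; ring.
Qed.

(** * Width, gradients and step sizes along the run *)

Section Algorithm.
Variables (R : realType) (n d : nat) (P C : 'M[R]_(n, d)) (eps : R).
Hypotheses (n0 : (0 < n)%N) (d0 : (0 < d)%N).
Hypotheses (P0 : forall j i, 0 <= P j i) (C0 : forall j i, 0 <= C j i).
Hypothesis Pcol : forall i, col i P != 0.
Hypothesis eps0 : 0 < eps.

Local Notation N := (ndrho P C).
Local Notation K := (threshold P C eps).
Local Notation M i := (vmax (fun j => P j i)).

Lemma vmax_col_gt0 i : 0 < M i.
Proof.
have [j0 j0E jM] := vmax_attained (fun j => P j i) n0.
rewrite lt_neqAle -j0E P0 andbT; apply: contra (Pcol i) => /eqP z.
apply/eqP/colP => j; rewrite !mxE; apply/eqP.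
by rewrite eq_le P0 andbT z j0E.
Qed.

Lemma le_width j i : C j i <= width P C * M i.
Proof.
have [_ _ iM] := vmax_attained
  (fun i => vmax (fun j => C j i) / M i) d0.
have [_ _ jM] := vmax_attained (fun j => C j i) n0.
by apply: le_trans (jM j) _; rewrite -ler_pdivrMr ?vmax_col_gt0.
Qed.

Lemma width_ge0 : 0 <= width P C.
Proof.
have i := Ordinal d0; have j := Ordinal n0.
have := le_trans (C0 j i) (le_width j i).
by rewrite pmulr_lge0 ?vmax_col_gt0.
Qed.

Lemma ndrho_ge0 : 0 <= N.
Proof. by rewrite /ndrho !mulr_ge0 ?width_ge0. Qed.

Lemma gradP_ge0 x i : 0 <= gradP P x i 0.
Proof.
rewrite mxE; apply: sumr_ge0 => j _.
by rewrite mulr_ge0 ?softmax_ge0 // mxE.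
Qed.

Lemma gradC_ge0 x i : 0 <= gradC C x i 0.
Proof.
rewrite mxE; apply: sumr_ge0 => j _.
by rewrite mulr_ge0 ?softmax_ge0 // mxE.
Qed.

Lemma delta_bounds x i : 0 <= delta P C eps x i 0 <= 1 / 2.
Proof.
rewrite mxE; case: ifPn => [|_]; last by rewrite lexx; lra.
rewrite inE => h.
have r0 : 0 <= gradP P x i 0 / gradC C x i 0.
  by rewrite divr_ge0 ?gradP_ge0 ?gradC_ge0.
have r1 : gradP P x i 0 / gradC C x i 0 <= 1.
  (* When the C-gradient vanishes, the ratio is 0 because the inverse of 0 is 0. *)
  have := gradC_ge0 x i; rewrite le_eqVlt => /predU1P[<-|c0].
    by rewrite invr0 mulr0.
  by rewrite ler_pdivrMr // mul1r; move: h eps0; nra.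
lra.
Qed.

(** A nonzero step puts i in [wset]. There the bound is an equality by definition of [delta], unless
    the C-gradient is 0, which forces the P-gradient to be at most 0. *)
Lemma gradP_le_gradC x i : delta P C eps x i 0 != 0 ->
  gradP P x i 0 <= gradC C x i 0 * (1 - 2 * delta P C eps x i 0).
Proof.
rewrite mxE; case: ifPn => [|_]; last by rewrite eqxx.
rewrite inE => h _.
have := gradC_ge0 x i; rewrite le_eqVlt => /predU1P[c0|c0].
  by move: h; rewrite -c0 !(mulr0, mul0r).
rewrite le_eqVlt; apply/orP; left; apply/eqP; field.
by rewrite gt_eqF.
Qed.

Lemma run_ge0 t x : 0 <= K -> run P C eps t = Running x ->
  forall i, 0 <= x i 0.
Proof.
move=> K0; elim: t x => [|t IH] x.
  move=> [<-] i; rewrite mxE divr_ge0 // mulr_ge0 //.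
  exact: ltW (vmax_col_gt0 i).
rewrite /run iterS -/(run P C eps t).
case: (run P C eps t) IH => //= y /(_ y erefl) y0.
case: ifP => // _; case: ifP => // _ [<-] i.
rewrite mxE mulr_ge0 // addr_ge0 // mulr_ge0 //.
  by rewrite /alpha divr_ge0 // mulr_ge0.
by have /andP[] := delta_bounds y i.
Qed.

Lemma mulmx_update (A : 'M[R]_(n, d)) x :
  A *m update P C eps x =
  A *m x + \col_j \sum_i A j i * x i 0 *
                         (alpha P C eps * delta P C eps x i 0).
Proof.
apply/colP => j; rewrite !mxE -big_split /=; apply: eq_bigr => i _.
by rewrite [update _ _ _ _ i 0]mxE; ring.
Qed.

(** * Change of the potential in one update *)

Section Update.
Variable x : 'cV[R]_d.
Hypotheses (x0 : forall i, 0 <= x i 0) (K0 : 0 < K).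
Hypothesis loop : continue_loop P C eps x.

Local Notation dl i := (delta P C eps x i 0).
Local Notation al := (alpha P C eps).

Let dlP i : 0 <= dl i <= 1 / 2 := delta_bounds x i.

Lemma mulmx_P_le j : (P *m x) j 0 <= K.
Proof.
have [_ _ jM] := vmax_attained (fun j => (P *m x) j 0) n0.
by move: loop => /andP[+ _]; exact: le_trans (jM j).
Qed.

Lemma mulmx_C_le j : (C *m x) j 0 <= N * K / n%:R.
Proof.
have -> : N * K / n%:R = \sum_(i < d) width P C * K.
  rewrite sumr_const card_ord -mulr_natl /ndrho; field.
  by rewrite pnatr_eq0 -lt0n.
rewrite mxE; apply: ler_sum => i _.
apply: le_trans (ler_wpM2r (x0 i) (le_width j i)) _.
rewrite -mulrA ler_wpM2l ?width_ge0 //.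
(* In a row k attaining the column maximum, P_ki x_i is a single term of (P x)_k <= K. *)
have [k <- _] := vmax_attained (fun j => P j i) n0.
apply: le_trans (mulmx_P_le k); rewrite mxE (bigD1 i) //= lerDl.
by apply: sumr_ge0 => l _; rewrite mulr_ge0.
Qed.

Lemma log_sum_exp_P_update :
  ln (\sum_j expR ((P *m update P C eps x) j 0)) <=
  ln (\sum_j expR ((P *m x) j 0)) +
  \sum_i gradP P x i 0 * (x i 0 * (al * dl i * (1 + dl i / 4))).
Proof.
rewrite mulmx_update; apply: le_trans (log_sum_exp_increment _ _ _ _ n0) _.
rewrite lerD2l -trmx_mul_softmax_sum; apply: ler_sum => j _.
rewrite ler_wpM2l ?softmax_ge0 // mxE lerBlDl.
under [in leRHS]eq_bigr do rewrite mulrA.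
apply: expR_step_le => // [i|]; first by rewrite mulr_ge0.
by have := mulmx_P_le j; rewrite mxE.
Qed.

Lemma log_sum_exp_C_update :
  ln (\sum_j expR (- (C *m update P C eps x) j 0)) <=
  ln (\sum_j expR (- (C *m x) j 0)) -
  \sum_i gradC C x i 0 * (x i 0 * (al * dl i * (1 - dl i / 4)))
  + expR (- K) * N.
Proof.
have oppE (v : 'cV[R]_n) : \sum_j expR (- v j 0) = \sum_j expR ((- v) j 0).
  by apply: eq_bigr => j _; rewrite [in RHS]mxE.
rewrite !oppE mulmx_update opprD.
apply: le_trans (log_sum_exp_increment _ _ _ _ n0) _.
rewrite -addrA lerD2l -trmx_mul_softmax_sum -sumrN.
(* The error is shared equally among the n rows, so that the bound can be proved row by row. *)
have -> : expR (- K) * N = \sum_(j < n) expR (- K) * (N / n%:R).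
  rewrite sumr_const card_ord -mulr_natl; field.
  by rewrite pnatr_eq0 -lt0n.
rewrite -big_split /=; apply: ler_sum => j _.
set q := softmax _ j 0; have q0 : 0 <= q by exact: softmax_ge0.
under [in leRHS]eq_bigr do rewrite mulrA.
rewrite 2![in leLHS]mxE.
have w0 i : 0 <= C j i * x i 0 by rewrite mulr_ge0.
have e0 : 0 <= expR (- K) * (N / n%:R).
  by rewrite mulr_ge0 ?expR_ge0 // divr_ge0 // ndrho_ge0.
have [small|large] := leP ((C *m x) j 0) (2 * K).
  rewrite -[leLHS]addr0 lerD // -mulrN ler_wpM2l // lerBlDl.
  by apply: expRN_step_le => //; move: small; rewrite mxE.
have qK : q <= expR (- K).
  have [k kE _] := vmin_attained (fun j => (C *m x) j 0) n0.
  have kK : (C *m x) k 0 <= K by rewrite kE; move: loop => /andP[].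
  apply: le_trans (softmax_le _ _ _ j k) _.
  rewrite ler_expR [(- (C *m x)) j 0]mxE [(- (C *m x)) k 0]mxE; lra.
have := expRN_step_le_large _ _ _ _ _ K0 w0 dlP.
set b := expR _; set S := \sum_i _ * (_ * (1 - _)); set T := \sum_i _ => h.
have Nn0 : 0 <= N / n%:R by rewrite divr_ge0 // ndrho_ge0.
have TN : T / (16 * K) <= N / n%:R.
  rewrite ler_pdivrMr ?(mulr_gt0 _ K0) //.
  have := mulmx_C_le j; rewrite mxE -/T => /le_trans; apply.
  by have := mulr_ge0 Nn0 (ltW K0); lra.
apply: (@le_trans _ _ (q * (- S + N / n%:R))).
  by rewrite ler_wpM2l //; lra.
by rewrite mulrDr mulrN lerD2l ler_wpM2r.
Qed.

Lemma potential_update :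
  potential P C (update P C eps x) <= potential P C x + expR (- K) * N.
Proof.
rewrite /potential.
have := log_sum_exp_P_update; have := log_sum_exp_C_update.
set gC := \sum_i gradC C x i 0 * _; set gP := \sum_i gradP P x i 0 * _.
(* Coordinatewise this reduces to (1 - 2 dl)(1 + dl/4) <= 1 - dl/4. *)
suff : gP <= gC by lra.
apply: ler_sum => i _.
have [->|dn0] := eqVneq (dl i) 0; first by rewrite !(mulr0, mul0r).
have h := gradP_le_gradC _ _ dn0.
have /andP[dl0 dl1] := dlP i.
have w0 : 0 <= x i 0 * (al * dl i).
  by rewrite mulr_ge0 // mulr_ge0 // /alpha divr_ge0 // mulr_ge0 // ltW.
have swap (g c : R) : g * (x i 0 * (al * dl i * c)) =
    x i 0 * (al * dl i) * (g * c) by ring.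
rewrite !swap ler_wpM2l //.
have c0 := gradC_ge0 x i.
have d4 : 0 <= 1 + dl i / 4 by lra.
apply: le_trans (ler_wpM2r d4 h) _.
by rewrite -mulrA ler_wpM2l //; nra.
Qed.

End Update.

End Algorithm.

(** * Degenerate thresholds and the final size of the error *)

Theorem theorem3p1 (R : realType) (n d : nat) (P C : 'M[R]_(n, d)) (eps : R)
  (hn : (0 < n)%N) (hd : (0 < d)%N)
  (hP : forall j i, 0 <= P j i) (hC : forall j i, 0 <= C j i)
  (hPcol : forall i, col i P != 0)
  (heps_ge : (n%:R * d%:R) ^- 3 <= eps) (heps_le : eps <= 1 / 20)
  (t : nat) (x x' : 'cV[R]_d)
  (hx : run P C eps t = Running x)
  (hx' : run P C eps t.+1 = Running x')
  (hb : forall j, ndrho P C ^- 5 <= bvec P C eps x j 0 <= ndrho P C ^+ 5) :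
  potential P C x' <= potential P C x + ndrho P C ^- 15.
Proof.
have eps0 : 0 < eps.
  by apply: lt_le_trans heps_ge; rewrite invr_gt0 exprn_gt0 // mulr_gt0 ?ltr0n.
have N0 : 0 <= ndrho P C by exact: ndrho_ge0.
move: hx'; rewrite /run iterS -/(run P C eps t) hx /=.
case: ifP => // loop; case: ifP => // _ [<-].
(* Degenerate case: K = 0 makes alpha = 1 / 0 = 0, so x does not move. It covers
   N = 0 and N = 1; otherwise N^-5 <= N^5 forces N > 1. *)
have [K0|Kn0] := eqVneq (threshold P C eps) 0.
  have -> : update P C eps x = x.
    apply/colP => i.
    by rewrite mxE /alpha K0 mulr0 invr0 mulr0 mul0r addr0 mulr1.
  by rewrite lerDl invr_ge0 exprn_ge0.
have N1 : 1 < ndrho P C.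
  rewrite ltNge; apply: contra Kn0 => N1; rewrite /threshold.
  move: N1; rewrite le_eqVlt => /predU1P[->|N1].
    by rewrite ln1 mulr0 mul0r.
  (* [ln] takes the value 0 at 0, so N = 0 also gives K = 0. *)
  move: N0; rewrite le_eqVlt => /predU1P[<-|N0].
    by rewrite ln0 // mulr0 mul0r.
  have /andP[/le_trans/[apply]] := hb (Ordinal hn).
  have N5 : ndrho P C ^+ 5 < 1 by rewrite exprn_ilt1 // ltW.
  move=> /le_lt_trans/(_ N5); rewrite invf_lt1 ?exprn_gt0 //.
  by rewrite ltNge ltW.
have lnN0 := ln_gt0 N1.
(* The exponent 16 leaves N^-15 after the factor N in the error; eps <= 1/4 would already give
   it. *)
have K16 : 16%:R * ln (ndrho P C) <= threshold P C eps.
  by rewrite /threshold ler_pdivlMr //; nra.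
have K0 : 0 < threshold P C eps by apply: lt_le_trans K16; rewrite mulr_gt0.
have x0 : forall i, 0 <= x i 0 by apply: run_ge0 (ltW K0) hx.
have : potential P C (update P C eps x) <=
    potential P C x + expR (- threshold P C eps) * ndrho P C.
  exact: potential_update.
move=> /le_trans; apply; rewrite lerD2l.
have Np : 0 < ndrho P C by rewrite (lt_trans _ N1).
have : expR (- threshold P C eps) <= ndrho P C ^- 16.
  rewrite expRN lef_pV2 ?posrE ?expR_gt0 ?exprn_gt0 //.
  by rewrite -[X in X ^+ _]lnK ?posrE // -expRM_natl ler_expR.
move=> /(ler_wpM2r N0) /le_trans; apply.
by rewrite exprS invfM mulrAC mulVf ?mul1r // gt_eqF.
Qed.
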